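(* Fix $y\in Y$. The following statements are equivalent: (i) $\mathcal{K}\cap(\{y\}\times\mathbb{R})=\mathcal{M}\cap(\{y\}\times\mathbb{R})$; (ii) for any $\alpha\in\mathbb{R}$, the following two assertions (a) and (b) are equivalent: (a) for all $x\in P$ with $Ax-b\in Q$, we have $\langle x,c-y\rangle\ge\alpha$; (b) there exists $w\in Q^*$ such that $-A^*w+c-y\in P^*$ and $\langle b,w\rangle\ge\alpha$.
   Context: Setting: $(X,Y)$ and $(Z,W)$ are separated dual pairs of real vector spaces, i.e. there are bilinear forms on $X\times Y$ and on $Z\times W$, both denoted $\langle\cdot,\cdot\rangle$, such that $\langle x_0,y\rangle=0$ for all $y\in Y$ implies $x_0=0$, and $\langle x,y_0\rangle=0$ for all $x\in X$ implies $y_0=0$ (and likewise for $(Z,W)$). No topology is assumed. $A:X\to Z$ is a linear map with adjoint $A^*:W\to Y$, a linear map satisfying $\langle x,A^*w\rangle=\langle Ax,w\rangle$ for all $x\in X$, $w\in W$ (assumed to exist). $P\subset X$ and $Q\subset Z$ are convex cones (nonempty, and $\alpha u+\beta v$ is in the cone for all $\alpha,\beta\ge 0$ and $u,v$ in the cone); $b\in Z$, $c\in Y$. Dual cones: $P^*=\{y\in Y:\langle x,y\rangle\ge 0\ \forall x\in P\}$, $Q^*=\{w\in W:\langle q,w\rangle\ge 0\ \forall q\in Q\}$. Feasible sets: $F(\mathcal{P})=\{x\in P: Ax-b\in Q\}$ and $F(\mathcal{D})=\{w\in Q^*:-A^*w+c\in P^*\}$; both are assumed nonempty. Definitions: $\mathcal{K}=\bigcup_{w\in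 Q^*}\big((-A^*w+c-P^* )\times\,]-\infty,\langle b,w\rangle]\big)\subset Y\times\mathbb{R}$; $v_{\mathcal{P}}(y)=\inf\{\langle x,c-y\rangle:x\in F(\mathcal{P})\}$ for $y\in Y$ (possibly $-\infty$); $\mathcal{M}=\mathrm{hypo}\,v_{\mathcal{P}}=\{(y,r)\in Y\times\mathbb{R}: r\le v_{\mathcal{P}}(y)\}$. *)

(* Defs.v *)
From HB Require Import structures.
From mathcomp Require Import all_boot all_order all_algebra.
From mathcomp Require Import boolp classical_sets set_interval.
From mathcomp Require Import reals constructive_ereal ereal.

Set Implicit Arguments.
Unset Strict Implicit.
Unset Printing Implicit Defensive.

Import Order.TTheory GRing.Theory Num.Theory.
Local Open Scope classical_set_scope.
Local Open Scope ring_scope.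

Notation "{ 'pairing' X , Y }" := {bilinear X -> Y -> _ | *%R & *%R}
  (at level 0, X at level 98, Y at level 98,
   format "{ 'pairing'  X ,  Y }") : type_scope.

Definition separated_pairing (R : realType) (X Y : lmodType R)
    (f : {pairing X, Y}) : Prop :=
  (forall x0, (forall y, f x0 y = 0) -> x0 = 0) /\
  (forall y0, (forall x, f x y0 = 0) -> y0 = 0).

Definition is_adjoint (R : realType) (X Y Z W : lmodType R)
    (f : {pairing X, Y}) (g : {pairing Z, W})
    (A : X -> Z) (B : W -> Y) : Prop :=
  forall x w, f x (B w) = g (A x) w.

Definition convex_cone (R : realType) (E : lmodType R) (C : set E) : Prop :=
  C !=set0 /\
  forall (a b : R) (u v : E),
    0 <= a -> 0 <= b -> C u -> C v -> C (a *: u + b *: v).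

Definition dual_cone (R : realType) (X Y : lmodType R) (f : {pairing X, Y})
    (C : set X) : set Y :=
  [set y | forall x, C x -> 0 <= f x y].

Definition primal_feasible (R : realType) (X Z : lmodType R)
    (A : X -> Z) (P : set X) (Q : set Z) (b : Z) : set X :=
  [set x | P x /\ Q (A x - b)].

Definition dual_feasible (R : realType) (X Y Z W : lmodType R)
    (f : {pairing X, Y}) (g : {pairing Z, W}) (B : W -> Y)
    (P : set X) (Q : set Z) (c : Y) : set W :=
  [set w | dual_cone g Q w /\ dual_cone f P (- B w + c)].

Definition setK (R : realType) (X Y Z W : lmodType R)
    (f : {pairing X, Y}) (g : {pairing Z, W}) (B : W -> Y)
    (P : set X) (Q : set Z) (b : Z) (c : Y) : set (Y * R) :=
  \bigcup_(w in dual_cone g Q)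
    ([set - B w + c - p | p in dual_cone f P] `*` `]-oo, g b w]).

Definition primal_value (R : realType) (X Y Z : lmodType R)
    (f : {pairing X, Y}) (A : X -> Z)
    (P : set X) (Q : set Z) (b : Z) (c : Y) (y : Y) : \bar R :=
  ereal_inf [set (f x (c - y))%:E | x in primal_feasible A P Q b].

Definition hypo (R : realType) (T : Type) (v : T -> \bar R) : set (T * R) :=
  [set yr | (yr.2%:E <= v yr.1)%E].

Definition setM (R : realType) (X Y Z : lmodType R)
    (f : {pairing X, Y}) (A : X -> Z)
    (P : set X) (Q : set Z) (b : Z) (c : Y) : set (Y * R) :=
  hypo (primal_value f A P Q b c).

(* Main.v *)
Require Import Defs.
From HB Require Import structures.
From mathcomp Require Import all_boot all_order all_algebra.
From mathcomp Require Import boolp classical_sets set_interval.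
From mathcomp Require Import reals constructive_ereal ereal.

Set Implicit Arguments.
Unset Strict Implicit.
Unset Printing Implicit Defensive.

Import Order.TTheory GRing.Theory Num.Theory.
Local Open Scope classical_set_scope.
Local Open Scope ring_scope.

(** Membership of a pair [(y, r)] in either set is already one of the two
    assertions to be compared, read at the level [alpha = r].  On the side of
    [setK], the point [y] has the form [- B w + c - p] with [p] in the dual
    cone of [P] exactly when [- B w + c - y] lies in that cone, so [(y, r)]
    is in [setK] iff some dual-feasible [w] for the perturbed cost [c - y]
    achieves at least [r] ([setKP]).  On the side of [setM], being below an
    infimum means being a lower bound ([setMP]).  Two subsets of the vertical
    line over [y] coincide iff they contain the same heights [r], and this is
    the equivalence of the two assertions for every [r]. *)

Lemma setKP (R : realType) (X Y Z W : lmodType R)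
    (f : {pairing X, Y}) (g : {pairing Z, W}) (B : W -> Y)
    (P : set X) (Q : set Z) (b : Z) (c y : Y) (r : R) :
  setK f g B P Q b c (y, r) <->
  exists w, [/\ dual_cone g Q w, dual_cone f P (- B w + c - y) & r <= g b w].
Proof.
split=> [[w Qw [/= [p Pp <-]]]|[w [Qw Pw rw]]].
  by rewrite in_itv /= => rw; exists w; split; rewrite // subKr.
exists w => //; split=> /=; last by rewrite in_itv.
by exists (- B w + c - y); rewrite // subKr.
Qed.

Lemma setMP (R : realType) (X Y Z : lmodType R) (f : {pairing X, Y})
    (A : X -> Z) (P : set X) (Q : set Z) (b : Z) (c y : Y) (r : R) :
  setM f A P Q b c (y, r) <->
  forall x, P x -> Q (A x - b) -> r <= f x (c - y).
Proof.
split=> [rv x Px Qx|rf].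
  rewrite -lee_fin; apply: le_trans rv _.
  by apply: ereal_inf_lbound; exists x.
by apply: le_ereal_inf_tmp => _ [x [Px Qx] <-]; rewrite lee_fin; exact: rf.
Qed.

Lemma eq_vertical_sliceP (T U : Type) (S S' : set (T * U)) (t : T) :
  S `&` ([set t] `*` [set: U]) = S' `&` ([set t] `*` [set: U]) <->
  forall u, S (t, u) <-> S' (t, u).
Proof.
split=> [/seteqP[SS' S'S] u|SS'].
  by split=> Stu; [case: (SS' (t, u))|case: (S'S (t, u))].
by apply/seteqP; split=> -[t' u] [/= + [/= tt' _]]; rewrite tt' => /SS'.
Qed.

Theorem theorem4p3 (R : realType) (X Y Z W : lmodType R)
    (f : {pairing X, Y}) (g : {pairing Z, W})
    (f_sep : separated_pairing f) (g_sep : separated_pairing g)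
    (A : {linear X -> Z}) (B : {linear W -> Y}) (AB : is_adjoint f g A B)
    (P : set X) (Q : set Z) (P_cone : convex_cone P) (Q_cone : convex_cone Q)
    (b : Z) (c : Y)
    (FP_neq0 : primal_feasible A P Q b !=set0)
    (FD_neq0 : dual_feasible f g B P Q c !=set0)
    (y : Y) :
  setK f g B P Q b c `&` ([set y] `*` [set: R]) =
    setM f A P Q b c `&` ([set y] `*` [set: R])
  <->
  (forall alpha : R,
     (forall x, P x -> Q (A x - b) -> alpha <= f x (c - y)) <->
     (exists w, [/\ dual_cone g Q w,
                    dual_cone f P (- B w + c - y) &
                    alpha <= g b w])).
Proof.
rewrite eq_vertical_sliceP; split=> KM r.
  by rewrite -setMP -setKP; exact: iff_sym (KM r).
by rewrite setMP setKP; exact: iff_sym (KM r).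
Qed.
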